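(* Let $\mathcal A\in\mathbb C^{\mathbf I\times\mathbf I}$, $\mathcal B\in\mathbb C^{\mathbf H\times\mathbf I}$, $\mathcal C\in\mathbb C^{\mathbf I\times\mathbf H}$, $\mathcal D\in\mathbb C^{\mathbf H\times\mathbf H}$ be complex tensors. Put $\mathcal A^e=\mathcal A\mathcal A^D$, $\mathcal A^\pi=\mathcal I-\mathcal A\mathcal A^D$, $\mathcal Y=\mathcal C\mathcal D^D\mathcal B$, $\mathcal S=\mathcal A-\mathcal C\mathcal D^D\mathcal B$, $\mathcal Z=\mathcal D-\mathcal B\mathcal A^D\mathcal C$, $\mathcal H=\mathcal B\mathcal A^D$, $\mathcal K=\mathcal A^D\mathcal C$, $\mathcal S_{\mathcal A^e}=\mathcal A^e\mathcal S\mathcal A^e$ and $\mathcal T=\mathcal A^D+\mathcal K\mathcal Z^D\mathcal H$. Assume that $\mathcal S_{\mathcal A^e}\mathcal T=\mathcal A\mathcal A^D$ and that $\mathcal S\mathcal A^\pi$ is $t$-nilpotent for a positive integer $t$. (a) If $\mathcal S\mathcal A^\pi\mathcal Y\mathcal A^e=0$, then $$\mathcal S^D=-\sum_{i=0}^{t-2}(\mathcal I-\mathcal A^\pi\mathcal Y\mathcal T)\,\mathcal T^{i+2}\mathcal Y\mathcal A^\pi\mathcal S^i+\mathcal T-\mathcal A^\pi\mathcal Y\mathcal T^2 .$$ (b) If $\mathcal S\mathcal A^e\mathcal Y\mathcal A^\pi=0$, then $$\mathcal S^D=-\sum_{i=0}^{t-1}\mathcal S^i\mathcal A^\pi\mathcal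 Y\mathcal T^{i+2}+\mathcal T .$$
   Context: Fix positive integers $N,M,I_1,\dots,I_N,H_1,\dots,H_M$; write $\mathbf I=I_1\times\cdots\times I_N$ and $\mathbf H=H_1\times\cdots\times H_M$, and let $\mathbb C^{\mathbf J\times\mathbf L}$ ($\mathbf J,\mathbf L\in\{\mathbf I,\mathbf H\}$) denote the complex tensors with row multi-index in $\mathbf J$ and column multi-index in $\mathbf L$. Juxtaposition denotes the Einstein product (written $*_N$ in the paper): $(\mathcal P\mathcal Q)_{\mathbf j\mathbf l}=\sum_{\mathbf h}\mathcal P_{\mathbf j\mathbf h}\mathcal Q_{\mathbf h\mathbf l}$, the sum running over all values of the shared multi-index $\mathbf h$; it is associative. A tensor in $\mathbb C^{\mathbf J\times\mathbf J}$ is called square; $\mathcal I$ is the unit tensor (diagonal entries $1$, all others $0$) and $\mathcal P^0=\mathcal I$. The index $\mathrm{ind}(\mathcal P)$ of a square tensor is the smallest integer $l\ge 0$ such that $\mathcal P^l$ and $\mathcal P^{l+1}$ have the same range, where the range of $\mathcal P$ is $\{\mathcal P\mathcal X\}$. The Drazin inverse $\mathcal P^D$ is the (unique, always existing) square tensor $\mathcal X$ with $\mathcal P^l\mathcal X\mathcal P=\mathcal P^l$, $\mathcal X\mathcal P\mathcal X=\mathcal X$, $\mathcal P\mathcal X=\mathcal X\mathcal P$, where $l\ge\mathrm{ind}(\mathcal P)$. A square tensor $\mathcal P$ is $l$-nilpotent ($l$ a positive integer) if $\mathcal P^l=0$. A sum whose lower limit exceeds its upper limit is $0$. *)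

(* Defs.v *)
From HB Require Import structures.
From mathcomp Require Import all_boot all_order all_algebra.
From mathcomp Require Import boolp classical_sets reals.
From mathcomp Require Import complex.

Set Implicit Arguments.
Unset Strict Implicit.
Unset Printing Implicit Defensive.

Import GRing.Theory.
Local Open Scope ring_scope.

(* Multi-indices (i_1, ..., i_N) with i_k in {0, ..., d_k - 1}. *)
Definition midx (N : nat) (d : 'I_N -> nat) : finType :=
  {dffun forall k : 'I_N, 'I_(d k)}.

(* A record rather than an alias of the finite function type: the latter
   carries the entrywise product as canonical ring structure, and the product
   wanted here is the Einstein product. *)
Record tensor (K : Type) (J L : finType) : Type :=
  Tensor { tensor_val : {ffun J * L -> K} }.

Definition tensor_fun (K : Type) (J L : finType) (P : tensor K J L) (j : J)
  (l : L) : K := tensor_val P (j, l).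
Coercion tensor_fun : tensor >-> Funclass.

Definition mktensor (K : Type) (J L : finType) (f : J -> L -> K) :
  tensor K J L := Tensor [ffun p => f p.1 p.2].

HB.instance Definition _ (K : Type) (J L : finType) :=
  [isNew for @tensor_val K J L].
HB.instance Definition _ (K : eqType) (J L : finType) :=
  [Equality of tensor K J L by <:].
HB.instance Definition _ (K : choiceType) (J L : finType) :=
  [Choice of tensor K J L by <:].

Lemma tensorE (K : Type) (J L : finType) (f : J -> L -> K) j l :
  mktensor f j l = f j l.
Proof. by rewrite /tensor_fun ffunE. Qed.

Lemma tensorP (K : Type) (J L : finType) (P Q : tensor K J L) :
  (forall j l, P j l = Q j l) <-> P = Q.
Proof.
split=> [|-> //]; case: P Q => [p] [q] pq; congr Tensor.
by apply/ffunP => -[j l]; apply: pq.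
Qed.

Section TensorAlgebra.
Context {K : fieldType}.

Section Additive.
Context {J L : finType}.
Implicit Types P Q : tensor K J L.

Definition tzero : tensor K J L := mktensor (fun _ _ => 0).
Definition topp P : tensor K J L := mktensor (fun j l => - P j l).
Definition tadd P Q : tensor K J L := mktensor (fun j l => P j l + Q j l).

Fact taddA : associative tadd.
Proof. by move=> P Q S; apply/tensorP => j l; rewrite !tensorE addrA. Qed.
Fact taddC : commutative tadd.
Proof. by move=> P Q; apply/tensorP => j l; rewrite !tensorE addrC. Qed.
Fact tadd0 : left_id tzero tadd.
Proof. by move=> P; apply/tensorP => j l; rewrite !tensorE add0r. Qed.
Fact taddN : left_inverse tzero topp tadd.
Proof. by move=> P; apply/tensorP => j l; rewrite !tensorE addNr. Qed.

HB.instance Definition _ :=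
  GRing.isZmodule.Build (tensor K J L) taddA taddC tadd0 taddN.
End Additive.

Definition einstein (J H L : finType) (P : tensor K J H) (Q : tensor K H L) :
  tensor K J L := mktensor (fun j l => \sum_(h : H) P j h * Q h l).

Definition tunit (J : finType) : tensor K J J :=
  mktensor (fun j l => (j == l)%:R).

Lemma einsteinA (J H L M : finType) (P : tensor K J H) (Q : tensor K H L)
  (S : tensor K L M) :
  einstein P (einstein Q S) = einstein (einstein P Q) S.
Proof.
apply/tensorP => j m; rewrite !tensorE.
under eq_bigr do rewrite tensorE mulr_sumr.
under [RHS]eq_bigr do rewrite tensorE mulr_suml.
rewrite exchange_big /=; apply: eq_bigr => l _.
by apply: eq_bigr => h _; rewrite mulrA.
Qed.

Lemma einsteinDl (J H L : finType) (P Q : tensor K J H) (S : tensor K H L) :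
  einstein (P + Q) S = einstein P S + einstein Q S.
Proof.
apply/tensorP => j l; rewrite !tensorE -big_split /=.
by apply: eq_bigr => h _; rewrite tensorE mulrDl.
Qed.

Lemma einsteinDr (J H L : finType) (P : tensor K J H) (Q S : tensor K H L) :
  einstein P (Q + S) = einstein P Q + einstein P S.
Proof.
apply/tensorP => j l; rewrite !tensorE -big_split /=.
by apply: eq_bigr => h _; rewrite tensorE mulrDr.
Qed.

Lemma einstein1l (J L : finType) (P : tensor K J L) :
  einstein (tunit J) P = P.
Proof.
apply/tensorP => j l; rewrite !tensorE (bigD1 j) //= tensorE eqxx mul1r.
by rewrite big1 ?addr0 // => h; rewrite tensorE eq_sym => /negPf ->; rewrite mul0r.
Qed.

Lemma einstein1r (J L : finType) (P : tensor K J L) :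
  einstein P (tunit L) = P.
Proof.
apply/tensorP => j l; rewrite !tensorE (bigD1 l) //= tensorE eqxx mulr1.
by rewrite big1 ?addr0 // => h; rewrite tensorE => /negPf ->; rewrite mulr0.
Qed.

(* Square tensors form a ring: 1 is the unit tensor, P * Q is einstein P Q, and
   hence P ^+ 0 = 1. *)
HB.instance Definition _ (J : finType) :=
  GRing.Zmodule_isPzRing.Build (tensor K J J)
    (@einsteinA J J J J) (@einstein1l J J) (@einstein1r J J)
    (@einsteinDl J J J) (@einsteinDr J J J).

Lemma einsteinE (J : finType) (P Q : tensor K J J) : einstein P Q = P * Q.
Proof. by []. Qed.

Lemma tunitE (J : finType) : tunit J = 1. Proof. by []. Qed.

(* The range of P is a set of tensors with row multi-index only. *)
Definition tapply (J L : finType) (P : tensor K J L) (x : {ffun L -> K}) :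
  {ffun J -> K} := [ffun j => \sum_(l : L) P j l * x l].

Definition trange (J L : finType) (P : tensor K J L) : set {ffun J -> K} :=
  range (tapply P).

Lemma tapplyM (J H L : finType) (P : tensor K J H) (Q : tensor K H L) x :
  tapply (einstein P Q) x = tapply P (tapply Q x).
Proof.
apply/ffunP => j; rewrite !ffunE.
under eq_bigr do rewrite tensorE mulr_suml.
under [RHS]eq_bigr do rewrite ffunE mulr_sumr.
rewrite exchange_big /=; apply: eq_bigr => h _.
by apply: eq_bigr => l _; rewrite mulrA.
Qed.

Lemma trange_sub (J H L : finType) (P : tensor K J H) (Q : tensor K J L) :
  (trange P `<=` trange Q)%classic <-> exists X, P = einstein Q X.
Proof.
split=> [PQ|[X ->] _ [x _ <-]]; last by exists (tapply X x); rewrite ?tapplyM.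
have /choice[x xP] h : exists x, tapply Q x = [ffun j => P j h].
  have [|x _ xP] := PQ [ffun j => P j h]; last by exists x.
  exists [ffun h' => (h' == h)%:R] => //; apply/ffunP => j; rewrite !ffunE.
  rewrite (bigD1 h) //= ffunE eqxx mulr1 big1 ?addr0 // => h' /negPf h'h.
  by rewrite ffunE h'h mulr0.
exists (mktensor (fun l h => x h l)); apply/tensorP => j h.
have /ffunP/(_ j) := xP h; rewrite !ffunE tensorE => <-.
by apply: eq_bigr => l _; rewrite tensorE.
Qed.

Section Square.
Context {J : finType}.
Implicit Types P Q X : tensor K J J.

Let tmx P : 'M[K]_#|J| := \matrix_(i, j) P (enum_val i) (enum_val j).

Let tmx_inj : injective tmx.
Proof.
move=> P Q /matrixP PQ; apply/tensorP => j l.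
by have := PQ (enum_rank j) (enum_rank l); rewrite !mxE !enum_rankK.
Qed.

Let tmxK (A : 'M[K]_#|J|) :
  tmx (mktensor (fun j l => A (enum_rank j) (enum_rank l))) = A.
Proof. by apply/matrixP => i j; rewrite mxE tensorE !enum_valK. Qed.

Let tmxM P Q : tmx (P * Q) = tmx P * tmx Q.
Proof.
apply/matrixP => i j; rewrite !mxE tensorE (reindex _ (onW_bij _ (@enum_val_bij J))).
by apply: eq_bigr => k _; rewrite !mxE.
Qed.

Let tmx1 : tmx 1 = 1.
Proof.
by apply/matrixP => i j; rewrite !mxE tensorE (inj_eq (@enum_val_inj _ _)).
Qed.

Let tmxX P k : tmx (P ^+ k) = tmx P ^+ k.
Proof. by elim: k => [|k IHk]; rewrite ?tmx1 // !exprS tmxM IHk. Qed.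

(* Cayley-Hamilton, with the power of 'X split off the characteristic
   polynomial. *)
Let mx_strongly_regular n (A : 'M[K]_n) :
  exists k, exists2 G : 'M[K]_n, GRing.comm A G & A ^+ k = A ^+ k.+1 * G.
Proof.
case: n A => [|n] A.
  by exists 0, 0; [rewrite /GRing.comm mulr0 mul0r | apply/matrixP => -[]].
have [k [q /implyP q0 pE]] := multiplicity_XsubC (char_poly A) 0.
rewrite subr0 in pE; have {q0} := q0 (monic_neq0 (char_poly_monic A)).
rewrite /root horner_coef0 => c0; set c := q`_0 in c0.
have [r qE] : exists r, q = r * 'X + c%:P.
  have /factor_theorem[r] : root (q - c%:P) 0.
    by rewrite /root !hornerE horner_coef0 subrr.
  by rewrite subr0 => rE; exists r; rewrite -rE subrK.
have /(congr1 (horner_mx A)) := pE; rewrite Cayley_Hamilton qE.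
rewrite rmorphM rmorphXn rmorphD rmorphM /= horner_mx_X horner_mx_C => ch.
have cAr : GRing.comm A (horner_mx A r) by exact: comm_mx_horner.
exists k, (- c^-1 *: horner_mx A r).
  by rewrite /GRing.comm -scalerAr -scalerAl cAr.
move: ch; rewrite mulrDl -scalemx1 -scalerAl mul1r.
move/esym/eqP; rewrite addrC addr_eq0 => /eqP ch.
rewrite -scalerAr exprSr -mulrA cAr.
have -> : A ^+ k * (horner_mx A r * A) = horner_mx A r * A * A ^+ k.
  rewrite -cAr; symmetry; apply: commrX; apply: commr_sym.
  by apply: commrM => //; apply: commr_refl.
by rewrite -[_ * _ * _]opprK -ch scaleNr scalerN opprK scalerA mulVf ?scale1r.
Qed.

Lemma strongly_regular P :
  exists k, exists2 G, GRing.comm P G & P ^+ k = P ^+ k.+1 * G.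
Proof.
have [k [G PG kG]] := mx_strongly_regular (tmx P).
exists k, (mktensor (fun j l => G (enum_rank j) (enum_rank l))).
  by apply: tmx_inj; rewrite !tmxM tmxK.
by apply: tmx_inj; rewrite tmxM !tmxX tmxK.
Qed.

Lemma trange_expr P k m : (k <= m)%N ->
  (trange (P ^+ m) `<=` trange (P ^+ k))%classic.
Proof.
by move=> km; apply/trange_sub; exists (P ^+ (m - k)); rewrite einsteinE -exprD subnKC.
Qed.

Lemma tindex_ex P : exists l, `[< trange (P ^+ l) = trange (P ^+ l.+1) >].
Proof.
have [k [G _ kG]] := strongly_regular P; exists k; apply/asboolP.
apply/seteqP; split; last exact: trange_expr.
by apply/trange_sub; exists G.
Qed.

Definition tindex P : nat := ex_minn (tindex_ex P).

Lemma tindexP P l : (tindex P <= l)%N ->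
  exists X, P ^+ l = P ^+ l.+1 * X.
Proof.
rewrite /tindex; case: ex_minnP => m /asboolP mE _ ml.
have [|X mX] := (@trange_sub _ _ _ (P ^+ m) (P ^+ m.+1)).1; first by rewrite mE.
by exists X; rewrite -(subnK ml) exprD mX einsteinE mulrA -exprD addnS.
Qed.

Definition is_drazin_at (l : nat) P X : Prop :=
  [/\ P ^+ l * X * P = P ^+ l, X * P * X = X & P * X = X * P].

Definition is_drazin P X : Prop :=
  exists2 l, (tindex P <= l)%N & is_drazin_at l P X.

Lemma is_drazin_atW l m P X :
  (l <= m)%N -> is_drazin_at l P X -> is_drazin_at m P X.
Proof.
move=> lm [X1 X2 X3]; split=> //.
by rewrite -(subnK lm) exprD -!mulrA [P ^+ l * _]mulrA X1.
Qed.

Lemma is_drazin_at_unique l m P X Z :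
  is_drazin_at l P X -> is_drazin_at m P Z -> X = Z.
Proof.
move=> /(is_drazin_atW (leq_maxl l m)) + /(is_drazin_atW (leq_maxr l m)).
move: (maxn l m) => n [X1 X2 X3] [Z1 Z2 Z3].
have idem W : W * P * W = W -> W * P = (W * P) ^+ n.+1.
  by move=> WPW; elim: n {X1 Z1} => // n IHn; rewrite exprS -IHn mulrA WPW.
have ZXZ : Z * P * (X * P) = Z * P.
  have cZ : GRing.comm Z P by rewrite /GRing.comm Z3.
  rewrite [in LHS]idem // [RHS]idem // exprMn_comm // [P ^+ n.+1]exprS -!mulrA.
  by rewrite [P ^+ n * _]mulrA X1.
have ZPn : Z * P * P ^+ n = P ^+ n.
  have cZP : GRing.comm (Z * P) P by rewrite /GRing.comm mulrA Z3.
  by rewrite (commrX n cZP) mulrA Z1.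
have ZXX : Z * P * (X * P) = X * P.
  have cX : GRing.comm X P by rewrite /GRing.comm X3.
  have cXn : X ^+ n.+1 * P ^+ n.+1 = P ^+ n.+1 * X ^+ n.+1.
    by apply: commrX; apply: commr_sym; apply: commrX.
  by rewrite [X * P]idem // exprMn_comm // cXn [P ^+ n.+1]exprSr -[P ^+ n * P * _]mulrA
    [_ * (P ^+ n * _)]mulrA ZPn.
have XZ : X * P = Z * P by rewrite -ZXX ZXZ.
by rewrite -X2 XZ -mulrA X3 XZ -Z3 mulrA Z2.
Qed.

Lemma is_drazin_all P X l :
  is_drazin P X -> (tindex P <= l)%N -> is_drazin_at l P X.
Proof.
case=> m _ [X1 X2 X3] /tindexP[Y0 lY]; split=> //.
have [Y mY] : exists Y, P ^+ l = P ^+ m * P ^+ l * Y.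
  elim: m {X1} => [|m [Y IHm]]; first by exists 1; rewrite mulr1 mul1r.
  exists (Y0 * Y); rewrite exprSr -!mulrA [P * _]mulrA -exprS.
  by rewrite [P ^+ l.+1 * _]mulrA -lY mulrA.
have cXP k : P ^+ k * (X * P) = X * P * P ^+ k.
  by apply: commr_sym; apply: commrX; rewrite /GRing.comm mulrA X3.
by rewrite -mulrA cXP mY !mulrA -cXP mulrA X1.
Qed.

Lemma drazin_ex P : exists X, is_drazin P X.
Proof.
have [k [G PG kG]] := strongly_regular P.
have ik : (tindex P <= k)%N.
  rewrite /tindex; case: ex_minnP => m _; apply; apply/asboolP/seteqP.
  by split; [apply/trange_sub; exists G | exact: trange_expr].
have kj j : P ^+ k = P ^+ (j + k) * G ^+ j.
  elim: j => [|j IHj]; first by rewrite mulr1.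
  by rewrite {1}IHj [in LHS]exprD kG mulrA -exprD addnS -addSn -mulrA -exprS.
exists (P ^+ k * G ^+ k.+1), k => //.
have cGP i j : G ^+ i * P ^+ j = P ^+ j * G ^+ i.
  by apply: commrX; apply: commr_sym; apply: commrX.
have cGP1 i := cGP i 1%N; rewrite !expr1 in cGP1.
split.
- by rewrite mulrA -mulrA cGP1 mulrA -exprD -exprSr -addSn -kj.
- rewrite mulrA; congr (_ * _).
  by rewrite -mulrA -exprS -mulrA cGP mulrA -exprD addnC -kj.
- by rewrite mulrA -exprS -mulrA cGP1 mulrA -exprSr.
Qed.

Definition drazin P : tensor K J J := sval (cid (drazin_ex P)).

Lemma drazinP P : is_drazin P (drazin P).
Proof. exact: svalP. Qed.

Lemma drazin_unique P X : is_drazin P X -> X = drazin P.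
Proof.
by case=> l _ PX; have [m _] := drazinP P; apply: is_drazin_at_unique PX.
Qed.

Definition tnilpotent (l : nat) P : Prop := (0 < l)%N /\ P ^+ l = 0.

End Square.
End TensorAlgebra.

Notation "P *e Q" := (einstein P Q)
  (at level 40, left associativity) : ring_scope.

(* Main.v *)
Require Import Defs.
From mathcomp Require Import all_boot all_order all_algebra.
From mathcomp Require Import boolp classical_sets reals complex.

Import GRing.Theory.
Local Open Scope ring_scope.

(** Write e = A A^D, p = 1 - e and cut the ring of square tensors into blocks
along the idempotent e. Since A commutes with e, the mixed blocks of S = A - Y
are those of -Y, and the two orthogonality hypotheses say S p S e = 0 in (a)
and S e S p = 0 in (b). The hypothesis on T says that a = e S e has T as a
right inverse in the corner ring of e; square tensors being finite dimensional,
T is then the inverse of a there ([corner_rinv_linv]).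

In both cases S has an invertible part similar to a and a nilpotent part. The
similarity is a pair u, v with S u = u a, v S = a v and v u = e, so that u v is
an idempotent commuting with S which cuts S down to a copy of a. If some power
of S kills the complementary idempotent 1 - u v, then S^D is the inverse of a
carried back, u T v ([drazin_intertwined]). What remains is to solve the two
linear equations. Write N = S p, which is nilpotent.

In (a), S p S e = 0 gives S (S T) = S e S e T = S e = (S T) a, so one may take
u = S T, which is e + p S T. Looking for v with v e = e, the equation
v S = a v becomes v = e + T v N; its solution is the geometric sum
e (1 + T N + T^2 N^2 + ...), finite because N is nilpotent
([drazin_spse0]).

In (b), invertibility of a forces e S p = 0, so S is block triangular, v = e
works, and u = e + p S T + S p S T^2 + S^2 p S T^3 + ... is again a finite
geometric sum, because S^i p = p N^i ([drazin_sesp0]).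

Finally p Y T = - p S T and T Y p = - T S p, as A commutes with p and
p T = T p = 0; this turns u T v into the two stated formulas. *)

(** The defining equations at any exponent l already force l to be at least
the index: P^l = P^l X P = P^(l+1) X. *)
Lemma drazin_eq (K : fieldType) (J : finType) (l : nat) (P X : tensor K J J) :
  is_drazin_at l P X -> drazin P = X.
Proof.
move=> PX; symmetry; apply: drazin_unique; exists l => //.
have [PXP _ cPX] := PX.
rewrite /tindex; case: ex_minnP => m _; apply; apply/asboolP/seteqP.
split; last exact: trange_expr.
by apply/trange_sub; exists X; rewrite einsteinE exprSr -mulrA cPX mulrA PXP.
Qed.

(** One-sided inverses are two-sided: strong regularity Q^k = Q^(k+1) G,
multiplied on the left by P^k, gives Q a right inverse G as well. *)
Lemma tensor_rinv_linv (K : fieldType) (J : finType) (P Q : tensor K J J) :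
  P * Q = 1 -> Q * P = 1.
Proof.
move=> PQ; have [k [G _ QG]] := strongly_regular Q.
have PQk j : P ^+ j * Q ^+ j = 1.
  by elim: j => [|j IHj]; rewrite ?mulr1 // exprSr exprS -mulrA (mulrA P) PQ mul1r.
have QG1 : Q * G = 1 by rewrite -[RHS](PQk k) QG exprSr !mulrA PQk mul1r.
by rewrite -[P]mulr1 -QG1 (mulrA P) PQ mul1r.
Qed.

(** The same for the corner ring of an idempotent e, by completing a and x with
the identity 1 - e of the complementary corner. *)
Lemma corner_rinv_linv (K : fieldType) (J : finType) (e a x : tensor K J J) :
  e * e = e -> e * a = a -> a * e = a -> e * x = x -> x * e = x ->
  a * x = e -> x * a = e.
Proof.
move=> ee ea ae ex xe ax.
have glue b c : b * e = b -> e * c = c ->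
    (b + (1 - e)) * (c + (1 - e)) = b * c + (1 - e).
  move=> be ec; rewrite mulrDl [X in _ + X]mulrBl mul1r !mulrDr ec.
  by rewrite !mulrN !mulr1 be ee !subrr !addr0 [c + _]addrC addrK.
have /tensor_rinv_linv : (a + (1 - e)) * (x + (1 - e)) = 1.
  by rewrite glue // ax addrC subrK.
by rewrite glue // => /(canRL (addrK _)) ->; rewrite subKr.
Qed.

(** The inverse x of a, transported along the similarity u, v between a and the
invertible part of s. Both s X and X s equal the idempotent u v, so the only
condition left is that a power of s kills its complement. *)
Lemma drazin_intertwined (K : fieldType) (J : finType)
    (s u v a x e : tensor K J J) (n : nat) :
  s * u = u * a -> v * s = a * v -> a * x = e -> x * a = e ->
  v * u = e -> u * e = u -> e * x = x ->
  s ^+ n * (1 - u * v) = 0 -> drazin s = u * x * v.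
Proof.
move=> su vs ax xa vu ue ex sn.
have sX : s * (u * x * v) = u * v by rewrite !mulrA su -(mulrA u) ax ue.
have Xs : u * x * v * s = u * v by rewrite -mulrA vs mulrA -(mulrA u) xa ue.
apply: (@drazin_eq _ _ n); split; last by rewrite sX Xs.
- by move/eqP: sn; rewrite mulrBr mulr1 subr_eq0 -mulrA Xs => /eqP.
- by rewrite Xs !mulrA -(mulrA u v u) vu ue.
Qed.

(** With p = 1 - e, the hypothesis s p s e = 0 says that s kills the part of
s e that leaves the corner of e. In front of x, the factor 1 + p s x is
u = e + p s x = s x, and the sum is v = e (1 + x N + ...) behind x, where
N = s p. *)
Lemma drazin_spse0 (K : fieldType) (J : finType) (s e x : tensor K J J)
    (t : nat) :
  e * e = e -> e * x = x -> x * e = x -> e * s * e * x = e -> (0 < t)%N ->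
  (s * (1 - e)) ^+ t = 0 -> s * (1 - e) * s * e = 0 ->
  drazin s =
    (1 + (1 - e) * s * x) * x * \sum_(0 <= i < t) x ^+ i * (s * (1 - e)) ^+ i.
Proof.
move=> ee ex xe ax; set p := 1 - e; set N := s * p; set a := e * s * e in ax *.
case: t => // t _ Nt Nse.
have ea : e * a = a by rewrite /a !mulrA ee.
have ae : a * e = a by rewrite /a -mulrA ee.
have xa : x * a = e by exact: (@corner_rinv_linv _ _ e).
have ep : e * p = 0 by rewrite /p mulrBr mulr1 ee subrr.
have pe : p * e = 0 by rewrite /p mulrBl mul1r ee subrr.
have pD : e + p = 1 by rewrite /p addrC subrK.
have NE : N = s * p by [].
have Np : N * p = N by rewrite /N -mulrA {2}/p mulrBl mul1r ep subr0.
have aE : a = e * s * e by [].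
clearbody p N a.
have Ne : N * e = 0 by rewrite NE -mulrA pe mulr0.
have Nsx : N * s * x = 0 by rewrite -ex mulrA Nse mul0r.
have NSs i : N ^+ i.+1 * s = N ^+ i.+2.
  rewrite exprSr -mulrA -[in LHS](mulr1 (N * s)) -pD mulrDr Nse add0r.
  by rewrite -(mulrA N) -NE mulrA -!exprSr.
pose G := \sum_(0 <= i < t.+1) x ^+ i * N ^+ i.
have GE : G = 1 + \sum_(0 <= i < t) x ^+ i.+1 * N ^+ i.+1.
  by rewrite /G big_nat_recl // mulr1.
pose u := e + p * s * x; pose v := e * G.
have ue : u * e = u by rewrite mulrDl ee -(mulrA _ x) xe.
have -> : (1 + p * s * x) * x * G = u * x * v.
  rewrite /v mulrA -[u * x * e]mulrA xe; congr (_ * _).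
  by rewrite !mulrDl mul1r ex.
have su : s * u = u * a.
  rewrite /u mulrDr mulrDl ea !mulrA -NE Nsx addr0 -(mulrA _ x a) xa.
  by rewrite -[in LHS](mul1r (s * e)) -pD mulrDl aE !mulrA.
have vs : v * s = a * v.
  have -> : v * s = a + \sum_(0 <= i < t.+1) e * x ^+ i * N ^+ i.+1.
    rewrite /v GE mulrDr mulr1 mulrDl big_nat_recl // mulr1 addrA.
    congr (_ + _).
      by rewrite -[in LHS](mulr1 (e * s)) -pD mulrDr aE NE -(mulrA e s p).
    rewrite mulr_sumr mulr_suml; apply: eq_bigr => i _.
    by rewrite -!mulrA NSs.
  rewrite big_nat_recr //= Nt mulr0 addr0 /v mulrA ae GE mulrDr mulr1.
  congr (_ + _); rewrite mulr_sumr; apply: eq_bigr => i _.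
  by rewrite (exprS x) !mulrA ax.
have vu : v * u = e.
  have Nu : N * u = 0 by rewrite /u mulrDr Ne add0r !mulrA Np Nsx.
  rewrite /v GE (mulrDr e) mulr1 mulrDl.
  rewrite {1}/u mulrDr ee !mulrA ep !mul0r addr0 mulr_sumr mulr_suml.
  rewrite big1 ?addr0 // => i _.
  by rewrite (exprSr N) !mulrA -(mulrA _ N) Nu mulr0.
(* As 1 - u v commutes with s and kills u from the left, it equals
   (1 - u v) (p - p s x); the factor p - p s x turns each power of s to its
   right into a power of N. *)
apply: (@drazin_intertwined _ _ _ _ _ a _ e t.+1) => //.
have uvs : u * v * s = s * (u * v) by rewrite -mulrA vs !mulrA su.
have cQ : s ^+ t.+1 * (1 - u * v) = (1 - u * v) * s ^+ t.+1.
  apply: commr_sym; apply: commrX.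
  by rewrite /GRing.comm mulrBl mulrBr uvs mul1r mulr1.
have Qu : (1 - u * v) * u = 0 by rewrite mulrBl mul1r -mulrA vu ue subrr.
rewrite cQ.
have Qe : (1 - u * v) * e = - ((1 - u * v) * (p * s * x)).
  by apply/eqP; rewrite -addr_eq0 -mulrDr -/u Qu.
have -> : 1 - u * v = (1 - u * v) * (p - p * s * x).
  by rewrite mulrBr -Qe -mulrDr (addrC p) pD mulr1.
have xse : x * (s * e) = e.
  by rewrite -xe -mulrA (mulrA e) -aE xa.
have ws : (p - p * s * x) * s = (p - p * s * x) * N.
  have sD : s = s * e + N by rewrite NE -mulrDr pD mulr1.
  rewrite [X in _ * X = _]sD mulrDr [X in X + _](_ : _ = 0) ?add0r //.
  by rewrite mulrBl -(mulrA _ x) xse mulrA subrr.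
have Ns : N * s ^+ t = N ^+ t.+1.
  by elim: (t) => [|i IHi]; rewrite ?mulr1 // exprSr mulrA IHi NSs.
by rewrite -mulrA exprS (mulrA _ s) ws -(mulrA _ N) Ns Nt !mulr0.
Qed.

(** The hypothesis s e s p = 0 says more than it seems: its e-block is
(e s e)(e s p), and e s e is invertible, so e s p = 0. *)
Lemma drazin_sesp0 (K : fieldType) (J : finType) (s e x : tensor K J J)
    (t : nat) :
  e * e = e -> e * x = x -> x * e = x -> e * s * e * x = e ->
  (s * (1 - e)) ^+ t = 0 -> s * e * s * (1 - e) = 0 ->
  drazin s =
    x + \sum_(0 <= i < t) s ^+ i * (1 - e) * s * x ^+ i.+2.
Proof.
move=> ee ex xe ax; set p := 1 - e; set N := s * p; set a := e * s * e in ax *.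
move=> Nt sesp.
have ea : e * a = a by rewrite /a !mulrA ee.
have ae : a * e = a by rewrite /a -mulrA ee.
have xa : x * a = e by exact: (@corner_rinv_linv _ _ e).
have ep : e * p = 0 by rewrite /p mulrBr mulr1 ee subrr.
have pD : e + p = 1 by rewrite /p addrC subrK.
have NE : N = s * p by [].
have aE : a = e * s * e by [].
clearbody p N a.
have esp : e * s * p = 0.
  by rewrite -xa aE -!mulrA (mulrA s e) (mulrA (s * e)) sesp !mulr0.
have es : e * s = a by rewrite -[LHS]mulr1 -pD mulrDr esp addr0.
(* By triangularity, powers of s never lead from p back to e. *)
have eSp i : e * (s ^+ i * p) = 0.
  elim: i => [|i IHi]; first by rewrite mul1r.
  by rewrite exprS !mulrA es aE -!mulrA IHi !mulr0.
have sp i : s ^+ i * p = p * N ^+ i.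
  elim: i => [|i IHi]; first by rewrite mul1r mulr1.
  have -> : s ^+ i.+1 * p = p * (s ^+ i.+1 * p).
    by rewrite -[LHS]mul1r -pD mulrDl eSp add0r.
  by rewrite exprS -mulrA IHi (mulrA s p) -NE -exprS.
have stp : s ^+ t * p = 0 by rewrite sp Nt mulr0.
pose u := e + \sum_(0 <= i < t) s ^+ i * p * s * x ^+ i.+1.
have ue : u * e = u.
  rewrite mulrDl ee mulr_suml; congr (_ + _); apply: eq_bigr => i _.
  by rewrite -mulrA exprSr -(mulrA _ x) xe.
have su : s * u = u * a.
  have xSa i : x ^+ i.+1 * a = x ^+ i * e by rewrite exprSr -mulrA xa.
  rewrite mulrDr mulrDl ea mulr_sumr mulr_suml.
  under eq_bigr do rewrite !mulrA -exprS.
  under [in RHS]eq_bigr do rewrite -mulrA xSa.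
  have -> : s * e = a + p * s * e.
    by rewrite -[in LHS](mul1r (s * e)) -pD mulrDl aE !mulrA.
  rewrite -addrA; congr (_ + _).
  (* The two sides drop the last and the first term of this sum. The last one
     vanishes by nilpotency, and the first is p s e. *)
  transitivity (\sum_(0 <= i < t.+1) s ^+ i * p * s * (x ^+ i * e)).
    rewrite big_nat_recl // !mul1r; congr (_ + _); apply: eq_bigr => i _.
    by rewrite (exprSr x) -(mulrA _ x) xe.
  by rewrite big_nat_recr //= stp !mul0r addr0.
have vu : e * u = e.
  rewrite mulrDr ee mulr_sumr big1 ?addr0 // => i _.
  by rewrite !mulrA -(mulrA e) eSp !mul0r.
have vs : e * s = a * e by rewrite es ae.
rewrite (@drazin_intertwined _ _ s u e a x e t) //; last first.
  have eQ : e * (1 - u) = 0 by rewrite mulrBr mulr1 vu subrr.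
  by rewrite ue -[1 - u]mul1r -{1}pD mulrDl eQ add0r mulrA stp mul0r.
rewrite -mulrA xe mulrDl ex mulr_suml; congr (_ + _); apply: eq_bigr => i _.
by rewrite -mulrA -exprSr.
Qed.

Theorem theorem3p1 (R : realType) (N M : nat) (I : 'I_N -> nat)
    (H : 'I_M -> nat) (hN : (0 < N)%N) (hM : (0 < M)%N)
    (hI : forall k, (0 < I k)%N) (hH : forall k, (0 < H k)%N)
    (A : tensor (complex R) (midx I) (midx I))
    (B : tensor (complex R) (midx H) (midx I))
    (C : tensor (complex R) (midx I) (midx H))
    (D : tensor (complex R) (midx H) (midx H)) (t : nat) (ht : (0 < t)%N) :
  let Id := tunit (midx I) : tensor (complex R) (midx I) (midx I) in
  let Ae := A *e drazin A in
  let Api := Id - A *e drazin A in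
  let Y := C *e drazin D *e B in
  let S := A - C *e drazin D *e B in
  let Z := D - B *e drazin A *e C in
  let Hh := B *e drazin A in
  let Kk := drazin A *e C in
  let SAe := Ae *e S *e Ae in
  let T := drazin A + Kk *e drazin Z *e Hh in
  SAe *e T = A *e drazin A ->
  tnilpotent t (S *e Api) ->
  (S *e Api *e Y *e Ae = 0 ->
    drazin S =
      - (\sum_(0 <= i < t.-1)
           (Id - Api *e Y *e T) *e T ^+ i.+2 *e Y *e Api *e S ^+ i)
      + T - Api *e Y *e T ^+ 2)
  /\
  (S *e Ae *e Y *e Api = 0 ->
    drazin S =
      - (\sum_(0 <= i < t) S ^+ i *e Api *e Y *e T ^+ i.+2) + T).
Proof.
move=> Id Ae Api Y S Z Hh Kk SAe T.
have [l _ [_ XAX AX]] := drazinP A.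
have eX : Ae * drazin A = drazin A by rewrite -[Ae]/(A * drazin A) AX.
have Xe : drazin A * Ae = drazin A by rewrite mulrA.
have ee : Ae * Ae = Ae by rewrite -{1}[Ae]/(A * drazin A) -mulrA Xe.
have cA : A * Ae = Ae * A by rewrite -{2}[Ae]/(A * drazin A) -mulrA -AX.
have eT : Ae * T = T.
  rewrite mulrDr eX; congr (_ + _).
  by rewrite -einsteinE /Kk !einsteinA (einsteinE Ae) eX.
have Te : T * Ae = T.
  rewrite mulrDl Xe; congr (_ + _).
  by rewrite -einsteinE /Hh -!einsteinA (einsteinE _ Ae) Xe.
have pE : Api = 1 - Ae by [].
have ep : Ae * Api = 0 by rewrite pE mulrBr mulr1 ee subrr.
have pe : Api * Ae = 0 by rewrite pE mulrBl mul1r ee subrr.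
have cAp : A * Api = Api * A by rewrite pE mulrBr mulrBl mulr1 mul1r cA.
have YE : Y = A - S by rewrite /S subKr.
rewrite !einsteinE -[A * drazin A]/Ae /SAe !einsteinE -[Id]/(1 : tensor _ _ _).
(* From here on only the relations above matter; opaque names also keep
   rewriting from looking inside the definitions. *)
clearbody Y S T Api Ae => sT [ht' Nt].
have pT : Api * T = 0 by rewrite -eT mulrA pe mul0r.
have pYT k : Api * Y * T ^+ k.+1 = - (Api * S * T ^+ k.+1).
  rewrite YE mulrBr mulrBl exprS (mulrA (Api * A)) -cAp.
  by rewrite -(mulrA A) pT mulr0 mul0r sub0r.
have TYp k : T ^+ k.+1 * Y * Api = - (T ^+ k.+1 * (S * Api)).
  have Tp : T ^+ k.+1 * Api = 0 by rewrite exprSr -Te -!mulrA ep !mulr0.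
  by rewrite YE -mulrA mulrBl mulrBr cAp (mulrA _ Api) Tp mul0r sub0r.
split=> h.
- have h' : S * Api * S * Ae = 0.
    rewrite -[LHS]opprK -[RHS]oppr0 -h YE; congr (- _).
    rewrite mulrBr mulrBl -(mulrA (S * Api) A) cA mulrA -(mulrA S Api Ae) pe.
    by rewrite mulr0 mul0r sub0r.
  have NS i : S * Api * S ^+ i = (S * Api) ^+ i.+1.
    elim: i => [|i IHi]; first by rewrite mulr1.
    rewrite exprSr mulrA IHi exprSr -mulrA -[in LHS](mulr1 (_ * S)).
    rewrite -(subrK Ae 1) -pE mulrDr h' addr0.
    by rewrite -(mulrA (S * Api)) mulrA -!exprSr.
  rewrite (@drazin_spse0 _ _ _ Ae T t) -?pE //.
  case: t ht {ht' Nt} => // t _ /=.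
  have pYT1 := pYT 0; rewrite expr1 in pYT1.
  rewrite big_nat_recl // mulr1 mulrDr mulr1 mulr_sumr.
  rewrite {1}mulrDl mul1r -(mulrA _ T) -expr2.
  rewrite (pYT 1) opprK addrC addrA; congr (_ + _ + _).
  rewrite -sumrN; apply: eq_bigr => i _.
  rewrite !einsteinE pYT1 opprK; set u := 1 + _.
  rewrite -(mulrA u _ Y) -(mulrA u _ Api) TYp mulrN mulNr opprK.
  by rewrite -(mulrA u _ (S ^+ i)) -(mulrA (T ^+ _)) NS (exprS T i.+1) !mulrA.
- have h' : S * Ae * S * Api = 0.
    rewrite -[LHS]opprK -[RHS]oppr0 -h YE; congr (- _).
    rewrite mulrBr mulrBl -(mulrA (S * Ae) A) cAp mulrA -(mulrA S Ae Api) ep.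
    by rewrite mulr0 mul0r sub0r.
  rewrite (@drazin_sesp0 _ _ _ Ae T t) -?pE // addrC; congr (_ + _).
  rewrite -sumrN; apply: eq_bigr => i _.
  by rewrite !einsteinE -!(mulrA (S ^+ i)) pYT mulrN opprK !mulrA.
Qed.
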